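(* Let $\{r_\xi:\xi<\kappa\}\subseteq[0,1]$ be a (one-to-one) enumeration of a Luzin set, and let $f_\xi:[0,1]\setminus\{r_\xi\}\to[-1,1]$ ($\xi<\kappa$) be any splitting functions. Let $K$ be the split $[0,1]$ (unordered split interval) induced by $(f_\xi)_{\xi<\kappa}$. Then no nonmetrizable compact subspace of any continuous image of $K$ is totally disconnected.
   Context: A Luzin set is an uncountable subset of $\mathbb R$ whose intersection with every nowhere dense subset of $\mathbb R$ is countable. Split $M$ (definition), here with $M=[0,1]$ and $K_\xi=[-1,1]$: given a compact metrizable $M$ without isolated points, compact metrizable $K_\xi$ ($\xi<\kappa$), distinct points $r_\xi\in M$, and continuous $f_\xi:M\setminus\{r_\xi\}\to K_\xi$ (''splitting functions'') such that $f_\xi[U\setminus\{r_\xi\}]$ is dense in $K_\xi$ for every open neighbourhood $U$ of $r_\xi$, the split $M$ induced by $(f_\xi)_{\xi<\kappa}$ is the subspace $K$ of $M^{\{*\}}\times\prod_{\xi<\kappa}K_\xi$ consisting of the points $x_{\xi,t}$ ($\xi<\kappa$, $t\in K_\xi$) with $x_{\xi,t}( * )=r_\xi$, $x_{\xi,t}(\xi)=t$, $x_{\xi,t}(\eta)=f_\eta(r_\xi)$ for $\eta\ne\xi$, and the points $x_r$ ($r\in M\setminus\{r_\xi:\xi<\kappa\}$) with $x_r( * )=r$, $x_r(\xi)=f_\xi(r)$ for all $\xi$.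
   Formalization: The continuous image of K is required to be Hausdorff (the usual convention); without this the claim fails, e.g. for a convergent sequence with two limits inside an interval with doubled origin. *)

(* Defs.v *)
From Stdlib Require Import Reals List Classical.
Open Scope R_scope.

Definition countable_set (A : R -> Prop) : Prop :=
  exists e : nat -> R, forall x, A x -> exists n, e n = x.

Definition in_closure (N : R -> Prop) (x : R) : Prop :=
  forall eps, 0 < eps -> exists y, N y /\ Rabs (y - x) < eps.

Definition nowhere_dense (N : R -> Prop) : Prop :=
  ~ exists x eps, 0 < eps /\ forall y, Rabs (y - x) < eps -> in_closure N y.

Definition luzin_set (L : R -> Prop) : Prop :=
  ~ countable_set L /\
  forall N, nowhere_dense N -> countable_set (fun x => L x /\ N x).

Definition in01 (x : R) : Prop := 0 <= x <= 1.
Definition inpm1 (t : R) : Prop := -1 <= t <= 1.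

(* f : [0,1] \ {c} -> [-1,1] continuous, and f[U \ {c}] dense in [-1,1]
   for every neighbourhood U of c in [0,1] (it suffices to test the basic
   neighbourhoods [0,1] ∩ (c - delta, c + delta)). *)
Definition splitting_function (c : R) (f : R -> R) : Prop :=
  (forall x, in01 x -> x <> c -> inpm1 (f x)) /\
  (forall x, in01 x -> x <> c ->
     forall eps, 0 < eps -> exists delta, 0 < delta /\
       forall y, in01 y -> y <> c -> Rabs (y - x) < delta ->
         Rabs (f y - f x) < eps) /\
  (forall delta, 0 < delta -> forall t, inpm1 t -> forall eps, 0 < eps ->
     exists y, in01 y /\ y <> c /\ Rabs (y - c) < delta /\
       Rabs (f y - t) < eps).

(* Points of M^{star} x prod_xi K_xi are represented as pairs (p at star, then (p xi)_xi). *)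
Definition split_point {I : Type} (r : I -> R) (f : I -> R -> R)
  (p : R * (I -> R)) : Prop :=
  (exists xi t, inpm1 t /\ fst p = r xi /\ snd p xi = t /\
     forall eta, eta <> xi -> snd p eta = f eta (r xi))
  \/
  (in01 (fst p) /\ (forall xi, fst p <> r xi) /\
     forall xi, snd p xi = f xi (fst p)).

(* product (Tychonoff) topology on R x R^I; K carries the subspace topology,
   which coincides with the subspace topology from [0,1] x prod [-1,1]. *)
Definition prod_open {I : Type} (U : R * (I -> R) -> Prop) : Prop :=
  forall p, U p -> exists delta, 0 < delta /\ exists l : list I,
    forall q, Rabs (fst q - fst p) < delta ->
      (forall i, In i l -> Rabs (snd q i - snd p i) < delta) -> U q.

Definition is_topology {Y : Type} (op : (Y -> Prop) -> Prop) : Prop :=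
  op (fun _ => True) /\
  (forall U V, op U -> op V -> op (fun y => U y /\ V y)) /\
  (forall F : (Y -> Prop) -> Prop, (forall U, F U -> op U) ->
     op (fun y => exists U, F U /\ U y)).

Definition hausdorff {Y : Type} (op : (Y -> Prop) -> Prop) : Prop :=
  forall a b, a <> b -> exists U V, op U /\ op V /\ U a /\ V b /\
    forall y, ~ (U y /\ V y).

Definition compact_in {Y : Type} (op : (Y -> Prop) -> Prop) (Z : Y -> Prop)
  : Prop :=
  forall (J : Type) (U : J -> Y -> Prop), (forall j, op (U j)) ->
    (forall z, Z z -> exists j, U j z) ->
    exists l : list J, forall z, Z z -> exists j, In j l /\ U j z.

Definition metrizable_in {Y : Type} (op : (Y -> Prop) -> Prop) (Z : Y -> Prop)
  : Prop :=
  exists d : Y -> Y -> R,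
    (forall x y, Z x -> Z y -> 0 <= d x y) /\
    (forall x y, Z x -> Z y -> (d x y = 0 <-> x = y)) /\
    (forall x y, Z x -> Z y -> d x y = d y x) /\
    (forall x y w, Z x -> Z y -> Z w -> d x w <= d x y + d y w) /\
    (forall A : Y -> Prop,
       (exists V, op V /\ forall z, Z z -> (A z <-> V z)) <->
       (forall z, Z z -> A z -> exists eps, 0 < eps /\
          forall w, Z w -> d z w < eps -> A w)).

Definition connected_in {Y : Type} (op : (Y -> Prop) -> Prop) (C : Y -> Prop)
  : Prop :=
  ~ exists U V, op U /\ op V /\
      (forall y, C y -> U y \/ V y) /\
      (exists a, C a /\ U a) /\ (exists b, C b /\ V b) /\
      (forall y, C y -> ~ (U y /\ V y)).

Definition totally_disconnected_in {Y : Type} (op : (Y -> Prop) -> Prop)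
  (Z : Y -> Prop) : Prop :=
  forall C, (forall y, C y -> Z y) -> connected_in op C ->
    forall a b, C a -> C b -> a = b.

(* Main.v *)
Require Import Defs.
From Stdlib Require Import Reals List Classical.
From Stdlib Require Import Lra Lia Arith Cantor.
From Stdlib Require Import FunctionalExtensionality PropExtensionality ClassicalEpsilon.
From Coquelicot Require Import Coquelicot.
Open Scope R_scope.

(** Let [L] be the preimage of [Z] in the split interval. If the fibre over
    [r xi] meets [L] without being contained in it, then arbitrarily close to
    [r xi] there are intervals over which all fibres miss [L]; hence such
    [r xi] form a nowhere dense set, and by the Luzin property there are only
    countably many of them. Every other fibre that meets [L] is an arc mapped
    into [Z], so it is collapsed to a point when [Z] is totally disconnected.
    Therefore [Z] only sees countably many coordinates of the split interval,
    which yields a countable network on [Z]. A compact Hausdorff totally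
    disconnected space with a countable network has a countable family of
    clopen sets separating its points, hence an ultrametric. *)

(** * Compact Hausdorff spaces *)

Section Topology.

Variables (Y : Type) (op : (Y -> Prop) -> Prop).
Hypothesis Htop : is_topology op.

Lemma open_local (V : Y -> Prop) :
  (forall y, V y -> exists U, op U /\ U y /\ forall w, U w -> V w) -> op V.
Proof.
  intros H. destruct Htop as [_ [_ Hu]].
  replace V with (fun y => exists U, (op U /\ forall w, U w -> V w) /\ U y).
  - apply Hu. tauto.
  - apply functional_extensionality. intros y. apply propositional_extensionality.
    split.
    + intros [U [[_ HU] Uy]]. auto.
    + intros Vy. destruct (H y Vy) as [U [HU [Uy HV]]]. exists U. tauto.
Qed.

Lemma open_and (U V : Y -> Prop) : op U -> op V -> op (fun y => U y /\ V y).
Proof. destruct Htop as [_ [H _]]. auto. Qed.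

Lemma open_or (U V : Y -> Prop) : op U -> op V -> op (fun y => U y \/ V y).
Proof.
  intros HU HV. apply open_local. intros y [H|H].
  - exists U. auto.
  - exists V. auto.
Qed.

Lemma open_union (F : (Y -> Prop) -> Prop) :
  (forall U, F U -> op U) -> op (fun y => exists U, F U /\ U y).
Proof. destruct Htop as [_ [_ H]]. auto. Qed.

Lemma open_forall_in (J : Type) (U : J -> Y -> Prop) (l : list J) :
  (forall j, In j l -> op (U j)) -> op (fun y => forall j, In j l -> U j y).
Proof.
  induction l as [|a l IH]; intros H.
  - apply open_local. intros y _. exists (fun _ => True).
    split; [apply Htop|]. split; [exact Logic.I|]. intros w _ j [].
  - apply open_local. intros y Hy.
    exists (fun y => U a y /\ forall j, In j l -> U j y). split.
    + apply open_and; [apply H; now left|]. apply IH. intros j Hj. apply H. now right.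
    + split; [split|].
      * apply Hy. now left.
      * intros j Hj. apply Hy. now right.
      * intros w [Ha Hl] j [<-|Hj]; auto.
Qed.

(** * Separation of disjoint compact sets *)

Definition separated (A B : Y -> Prop) : Prop :=
  exists U V, op U /\ op V /\ (forall y, A y -> U y) /\ (forall y, B y -> V y) /\
    forall y, ~ (U y /\ V y).

Lemma separated_sym (A B : Y -> Prop) : separated A B -> separated B A.
Proof. intros (U & V & H1 & H2 & H3 & H4 & H5). exists V, U.
  repeat split; auto. intros y [Hv Hu]. apply (H5 y). auto. Qed.

(** Finitely many neighbourhoods of points of [B] cover [B]; their union misses the intersection of
    the matching neighbourhoods of [A]. *)
Lemma separated_compact (A B : Y -> Prop) :
  compact_in op B -> (forall b, B b -> separated A (fun y => y = b)) ->
  separated A B.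
Proof.
  intros HB Hs.
  set (J := {p : (Y -> Prop) * (Y -> Prop) | op (fst p) /\ op (snd p) /\
    (forall y, A y -> fst p y) /\ forall y, ~ (fst p y /\ snd p y)}).
  destruct (HB J (fun j => snd (proj1_sig j))) as [l Hl].
  - intros [p Hp]. apply Hp.
  - intros b Hb. destruct (Hs b Hb) as (U & V & H1 & H2 & H3 & H4 & H5).
    assert (H : op (fst (U, V)) /\ op (snd (U, V)) /\
      (forall y, A y -> fst (U, V) y) /\ forall y, ~ (fst (U, V) y /\ snd (U, V) y))
      by (simpl; auto).
    exists (exist _ (U, V) H). simpl. auto.
  - exists (fun y => forall j : J, In j l -> fst (proj1_sig j) y),
      (fun y => exists W, (exists j : J, In j l /\ W = snd (proj1_sig j)) /\ W y).
    repeat split.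
    + apply open_forall_in. intros [p Hp] _. apply Hp.
    + apply open_union. intros W [[p Hp] [_ ->]]. apply Hp.
    + intros y Ay j _. destruct j as [p Hp]. simpl. apply Hp. exact Ay.
    + intros y By. destruct (Hl y By) as [j [Hj Vj]].
      exists (snd (proj1_sig j)). split; [|exact Vj]. now exists j.
    + intros y [H [W [[[p Hp] [Hj ->]] Wy]]]. specialize (H _ Hj). simpl in *.
      apply (proj2 (proj2 (proj2 Hp)) y). auto.
Qed.

(** Adding [O], under the index [None], turns a cover of the difference into a cover of [Z]. *)
Lemma compact_minus_open (Z O : Y -> Prop) :
  compact_in op Z -> op O -> compact_in op (fun y => Z y /\ ~ O y).
Proof.
  intros HZ HO J U HU Hc.
  destruct (HZ (option J) (fun o => match o with Some j => U j | None => O end))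
    as [l Hl].
  - intros [j|]; auto.
  - intros z Zz. destruct (classic (O z)) as [Oz|nOz].
    + now exists None.
    + destruct (Hc z) as [j Hj]; [auto|]. now exists (Some j).
  - exists (flat_map (fun o => match o with Some j => j :: nil | None => nil end) l).
    intros z [Zz nOz]. destruct (Hl z Zz) as [[j|] [Hj Uj]]; [|easy].
    exists j. split; [|exact Uj]. apply in_flat_map. exists (Some j). simpl. auto.
Qed.

Hypothesis Hhaus : hausdorff op.

Lemma compact_compact_separated (A B : Y -> Prop) :
  compact_in op A -> compact_in op B -> (forall y, ~ (A y /\ B y)) ->
  separated A B.
Proof.
  intros HA HB Hd. apply separated_compact; [exact HB|]. intros b Bb.
  apply separated_sym, separated_compact; [exact HA|]. intros a Aa.
  destruct (Hhaus b a) as (U & V & H1 & H2 & H3 & H4 & H5).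
  - intros ->. apply (Hd a). auto.
  - exists U, V. repeat split; auto; intros y ->; auto.
Qed.

Lemma compact_compl_open (Z : Y -> Prop) :
  compact_in op Z -> op (fun y => ~ Z y).
Proof.
  intros HZ. apply open_local. intros y nZy.
  destruct (compact_compact_separated Z (fun w => w = y)) as (U & V & _ & H2 & H3 & H4 & H5).
  - exact HZ.
  - intros J W _ Hc. destruct (Hc y eq_refl) as [j Hj].
    exists (j :: nil). intros z ->. exists j. simpl. auto.
  - intros w [Zw ->]. auto.
  - exists V. repeat split; auto. intros w Vw Zw. apply (H5 w). auto.
Qed.

(** * Clopen sets of a compact subspace and the ultrametric they define *)

Variable Z : Y -> Prop.
Hypothesis HZc : compact_in op Z.

(** Only the trace of [C] on [Z] matters, and openness is relative to [Z]. *)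
Definition clopen_in (C : Y -> Prop) : Prop :=
  exists V W, op V /\ op W /\ forall z, Z z -> (C z <-> V z) /\ (~ C z <-> W z).

(* In a compact space the intersection of the clopen neighbourhoods of a point
   is connected. *)
Lemma totally_disconnected_clopen (x y : Y) :
  totally_disconnected_in op Z -> Z x -> Z y -> x <> y ->
  exists C, clopen_in C /\ C x /\ ~ C y.
Proof.
  intros Htd Zx Zy Hxy. apply NNPP. intros Hno.
  (* [Q] is the quasi-component of [x] in [Z]. It contains [y], so its connectedness would force
     [x = y]. *)
  set (Q := fun w => Z w /\ forall C, clopen_in C -> C x -> C w).
  assert (Qx : Q x) by (split; auto).
  assert (Qy : Q y).
  { split; [exact Zy|]. intros C HC Cx. apply NNPP. intros nC. apply Hno. now exists C. }
  apply Hxy. apply (Htd Q); auto; [now intros w []|].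
  intros (U & V & HU & HV & Hcov & (a & Qa & Ua) & (b & Qb & Vb) & Hdis).
  (* On [Z], the members of [P] are the complements of clopen neighbourhoods of [x], so removing
     their union [O] from [Z] leaves exactly [Q]. *)
  set (P := fun W => op W /\ exists C, clopen_in C /\ C x /\ forall z, Z z -> (~ C z <-> W z)).
  set (O := fun w => exists W, P W /\ W w).
  assert (HO : op O) by (apply open_union; now intros W []).
  assert (HQ : forall w, Z w -> ~ O w -> Q w).
  { intros w Zw nO. split; [exact Zw|]. intros C HC Cx. apply NNPP. intros nC. apply nO.
    pose proof HC as (V' & W & _ & HW & HVW). exists W. split.
    - split; [exact HW|]. exists C. repeat split; auto; now apply HVW.
    - now apply HVW. }
  assert (HQO : forall w, Q w -> ~ O w).
  { intros w [Zw Qw] (W & (_ & C & HC & Cx & HCW) & Ww).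
    apply (HCW w Zw) in Ww. apply Ww, Qw; auto. }
  (* These two sets are the parts of [Q] in [U] and in [V], written as [Z] minus an open set to make
     their compactness visible. *)
  destruct (compact_compact_separated (fun w => Z w /\ ~ (O w \/ V w))
    (fun w => Z w /\ ~ (O w \/ U w))) as (O1 & O2 & H1 & H2 & HA & HB & H12).
  { apply compact_minus_open, open_or; auto. }
  { apply compact_minus_open, open_or; auto. }
  { intros w [[Zw nA] [_ nB]].
    destruct (Hcov w); [apply HQ; auto|tauto|tauto]. }
  destruct (HZc (option {W | P W})
    (fun o => match o with Some W => proj1_sig W | None => fun w => O1 w \/ O2 w end))
    as [l Hl].
  { intros [[W HW]|]; [apply HW|now apply open_or]. }
  { intros z Zz. destruct (classic (O z)) as [(W & HW & Wz)|nO].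
    - now exists (Some (exist _ W HW)).
    - exists None. destruct (Hcov z); [now apply HQ| |].
      + left. apply HA. split; [exact Zz|]. intros [?|Vz]; [tauto|].
        apply (Hdis z); auto.
      + right. apply HB. split; [exact Zz|]. intros [?|Uz]; [tauto|].
        apply (Hdis z); auto. }
  (* [bad] is the union of the finitely many members of [P] in the subcover. It misses [x], and off
     it [O1] and [O2] partition [Z]. *)
  set (bad := fun z => exists W, (exists HW : P W, In (Some (exist _ W HW)) l) /\ W z).
  assert (Hbad : op bad) by (apply open_union; intros W [[HW _] _]; exact HW).
  assert (nbx : ~ bad x).
  { intros (W & (HW & Hin) & Wx). apply (HQO x Qx). now exists W. }
  assert (Hcase : forall z, Z z -> bad z \/ O1 z \/ O2 z).
  { intros z Zz. destruct (Hl z Zz) as [[[W HW]|] [Hin Hz]]; [left|right; exact Hz].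
    exists W. split; [now exists HW|exact Hz]. }
  (* Finiteness of the subcover enters here: off [bad] is a finite intersection of relatively clopen
     sets. Adjoining the open complement of [Z] makes it open in [Y]. *)
  assert (Hgood : op (fun z => ~ bad z \/ ~ Z z)).
  { apply open_local. intros z Hz. destruct (classic (Z z)) as [Zz|nZz].
    - exists (fun w => (forall j : option {W | P W}, In j l ->
        match j with Some W => ~ proj1_sig W w \/ ~ Z w | None => True end)).
      split; [|split].
      + apply open_forall_in. intros [[W HW]|] _; [|apply Htop]. simpl.
        destruct HW as [HW (C & (V' & W' & HV' & HW' & HVW) & Cx & HC)].
        apply open_local. intros w Hw. exists (fun v => V' v \/ ~ Z v).
        split; [apply open_or; auto using compact_compl_open|]. split.
        * destruct (classic (Z w)) as [Zw|]; [left|now right].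
          apply (HVW w Zw). destruct Hw as [Hw|]; [|easy].
          apply NNPP. intros nC. now apply Hw, HC.
        * intros v [Vv|]; [|now right]. destruct (classic (Z v)) as [Zv|]; [left|now right].
          intros Wv. apply (HC v Zv) in Wv. apply Wv, (HVW v Zv), Vv.
      + intros [[W HW]|] Hin; [left|exact Logic.I]. simpl. intros Wz.
        destruct Hz as [Hz|]; [|easy]. apply Hz. exists W. split; [now exists HW|exact Wz].
      + intros w Hw. destruct (classic (Z w)) as [Zw|]; [left|now right].
        intros (W & (HW & Hin) & Ww). destruct (Hw _ Hin); auto.
    - exists (fun w => ~ Z w). split; [now apply compact_compl_open|]. auto. }
  assert (Hclo : forall O1 O2, op O1 -> op O2 -> (forall y, ~ (O1 y /\ O2 y)) ->
    (forall z, Z z -> bad z \/ O1 z \/ O2 z) ->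
    clopen_in (fun z => ~ bad z /\ O1 z)).
  { clear -Htop Hbad Hgood. intros O1 O2 H1 H2 H12 Hcase.
    exists (fun z => (~ bad z \/ ~ Z z) /\ O1 z), (fun z => bad z \/ O2 z).
    split; [now apply open_and|]. split; [now apply open_or|].
    intros z Zz. specialize (H12 z). specialize (Hcase z Zz). tauto. }
  assert (H21 : forall y, ~ (O2 y /\ O1 y)) by (intros w []; apply (H12 w); auto).
  assert (Hcase' : forall z, Z z -> bad z \/ O2 z \/ O1 z)
    by (intros z Zz; specialize (Hcase z Zz); tauto).
  (* The piece that contains [x] is clopen, hence contains all of [Q]; but [b], respectively [a],
     lies in the other piece. *)
  destruct (Hcase x Zx) as [?|[Ox|Ox]]; [easy| |].
  - destruct Qb as [Zb Qb'].
    destruct (Qb' _ (Hclo O1 O2 H1 H2 H12 Hcase)) as [_ Ob]; [now split|].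
    apply (H12 b). split; [exact Ob|]. apply HB. split; [exact Zb|].
    intros [Hb|Ub]; [now apply (HQO b)|]. now apply (Hdis b).
  - destruct Qa as [Za Qa'].
    destruct (Qa' _ (Hclo O2 O1 H2 H1 H21 Hcase')) as [_ Oa];
      [now split|].
    apply (H12 a). split; [|exact Oa]. apply HA. split; [exact Za|].
    intros [Ha|Va]; [now apply (HQO a)|]. now apply (Hdis a).
Qed.

(** Two points get the distance [/ (INR n + 1)] for the first [n] such that [C n] tells them apart.
    Compactness shows that relatively open sets are open for this ultrametric; the converse holds
    because the [C n] are clopen. *)
Lemma separating_clopen_metrizable (C : nat -> Y -> Prop) :
  (forall n, clopen_in (C n)) ->
  (forall x y, Z x -> Z y -> x <> y -> exists n, C n x /\ ~ C n y) ->
  metrizable_in op Z.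
Proof.
  intros HC Hsep.
  set (agree := fun n x y => forall k, (k < n)%nat -> (C k x <-> C k y)).
  assert (Hd : forall x y, exists d : R,
    ((forall n, agree n x y) -> d = 0) /\
    (forall n, agree n x y -> ~ agree (S n) x y -> d = / (INR n + 1))).
  { intros x y. destruct (classic (forall n, agree n x y)) as [H|H].
    - exists 0. split; [auto|]. intros n _ H'. now destruct H'.
    - assert (Hm : exists n, agree n x y /\ ~ agree (S n) x y).
      { apply NNPP. intros Hn. apply H. induction n as [|n IH].
        - intros k Hk. lia.
        - apply NNPP. intros Hs. apply Hn. eauto. }
      destruct Hm as [n [Hn1 Hn2]]. exists (/ (INR n + 1)). split; [easy|].
      intros m Hm1 Hm2. assert (m = n) as ->; [|reflexivity].
      destruct (lt_eq_lt_dec m n) as [[Hl|]|Hl]; [exfalso|auto|exfalso].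
      + apply Hm2. intros k Hk. apply Hn1. lia.
      + apply Hn2. intros k Hk. apply Hm1. lia. }
  destruct (choice (fun p d =>
    ((forall n, agree n (fst p) (snd p)) -> d = 0) /\
    (forall n, agree n (fst p) (snd p) -> ~ agree (S n) (fst p) (snd p) ->
      d = / (INR n + 1)))) as [d0 Hd0].
  { intros [x y]. apply Hd. }
  assert (Hcases : forall x y, ((forall n, agree n x y) /\ d0 (x, y) = 0) \/
    exists n, agree n x y /\ ~ agree (S n) x y /\ d0 (x, y) = / (INR n + 1)).
  { intros x y. destruct (Hd0 (x, y)) as [H1 H2]. simpl in *.
    destruct (classic (forall n, agree n x y)) as [H|H]; [auto|right].
    apply NNPP. intros Hn. apply H. induction n as [|n IH].
    - intros k Hk. lia.
    - apply NNPP. intros Hs. apply Hn. exists n. auto. }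
  assert (Hpos : forall n, 0 < / (INR n + 1)).
  { intros n. apply Rinv_0_lt_compat. pose proof (pos_INR n). lra. }
  assert (Hnn : forall x y, 0 <= d0 (x, y)).
  { intros x y. destruct (Hcases x y) as [[_ ->]|(n & _ & _ & ->)]; [lra|].
    left. apply Hpos. }
  (* Balls are agreement classes. The strict inequality excludes [n] itself as first difference,
     hence [S n]. *)
  assert (Hball : forall n x y, d0 (x, y) < / (INR n + 1) <-> agree (S n) x y).
  { intros n x y. destruct (Hcases x y) as [[Ha ->]|(m & Hm1 & Hm2 & ->)].
    - split; auto.
    - split.
      + intros Hlt k Hk. apply Hm1. destruct (le_lt_dec m k) as [Hl|]; [exfalso|easy].
        assert (INR m <= INR n) by (apply le_INR; lia).
        assert (/ (INR n + 1) <= / (INR m + 1)); [|lra].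
        apply Rinv_le_contravar; pose proof (pos_INR m); lra.
      + intros Ha. destruct (le_lt_dec m n) as [Hl|Hl].
        * destruct Hm2. intros k Hk. apply Ha. lia.
        * apply Rinv_lt_contravar; [|apply lt_INR in Hl; lra].
          pose proof (pos_INR m); pose proof (pos_INR n). nra. }
  exists (fun x y => d0 (x, y)). split; [auto|]. split; [|split; [|split]].
  - intros x y Zx Zy. split.
    + intros H0. apply NNPP. intros Hne. destruct (Hsep x y Zx Zy Hne) as [n [H1 H2]].
      apply H2. apply (proj1 (Hball n x y)) with (k := n); [rewrite H0; auto|lia|auto].
    + intros ->. apply (Hd0 (y, y)). now intros n k _.
  - intros x y _ _. destruct (Hcases x y) as [[Ha ->]|(n & Ha & Hb & ->)]; symmetry.
    + apply (Hd0 (y, x)). intros n k Hk. symmetry. apply (Ha n). exact Hk.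
    + apply (Hd0 (y, x)).
      * intros k Hk. symmetry. now apply Ha.
      * intros H. apply Hb. intros k Hk. symmetry. now apply H.
  - intros x y w _ _ _.
    destruct (Hcases x w) as [[Ha ->]|(n & Ha & Hb & ->)].
    + pose proof (Hnn x y). pose proof (Hnn y w). lra.
    (* If the sum were below [/ (INR n + 1)], so would be both summands, and agreement up to index
       [n] is transitive. *)
    + apply Rnot_lt_le. intros Hlt. apply Hb. intros k Hk.
      pose proof (Hnn x y). pose proof (Hnn y w).
      assert (H1 : agree (S n) x y) by (apply Hball; lra).
      assert (H2 : agree (S n) y w) by (apply Hball; lra).
      rewrite (H1 k Hk). now apply H2.
  - intros A. split.
    + intros (V & HV & HA) z Zz Az.
      (* [V] covers [z], and every other point of [Z] is cut off from [z] by some [C n]. Points that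
         agree with [z] at all indices of a finite subcover must therefore lie in [V]. *)
      destruct (HZc (option nat) (fun o y => match o with
        | None => V y
        | Some n => exists U, (op U /\ forall w, Z w -> U w -> ~ (C n z <-> C n w)) /\ U y
        end)) as [l Hl].
      { intros [n|]; [|exact HV]. apply open_union. now intros U []. }
      { intros w Zw. destruct (classic (z = w)) as [<-|Hne].
        - exists None. now apply HA.
        - destruct (Hsep z w Zz Zw Hne) as [n [H1 H2]]. exists (Some n).
          destruct (HC n) as (V' & W' & _ & HW' & HVW). exists W'. repeat split; auto.
          + intros v Zv Wv. apply (HVW v Zv) in Wv. tauto.
          + now apply (HVW w Zw). }
      assert (Hmax : exists N, forall n, In (Some n) l -> (n < N)%nat).
      { clear. induction l as [|[m|] l [N IH]].
        - exists 0%nat. easy.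
        - exists (S (m + N))%nat. intros n [[= ->]|H]; [lia|]. apply IH in H. lia.
        - exists N. intros n [[=]|H]. auto. }
      destruct Hmax as [N HN]. exists (/ (INR N + 1)). split; [apply Hpos|].
      intros w Zw Hw. apply Hball in Hw.
      destruct (Hl w Zw) as [[n|] [Hin Hn]]; [exfalso|now apply HA].
      destruct Hn as (U & [_ HU] & Uw). apply (HU w Zw Uw).
      apply Hw. apply HN in Hin. lia.
    + intros HA. exists (fun y => exists U, (op U /\ forall w, Z w -> U w -> A w) /\ U y).
      split; [apply open_union; now intros U []|]. intros z Zz. split.
      * intros Az. destruct (HA z Zz Az) as (eps & Heps & Hb).
        destruct (nfloor_ex (/ eps)) as [N [_ HN]].
        { left. now apply Rinv_0_lt_compat. }
        assert (Hlt : / (INR N + 1) < eps).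
        { rewrite <- (Rinv_inv eps). apply Rinv_lt_contravar; [|exact HN].
          apply Rmult_lt_0_compat; [now apply Rinv_0_lt_compat|].
          pose proof (pos_INR N). lra. }
        (* On [Z] this is agreement with [z] up to index [N], expressed through open sets of [Y]
           because [C k] is open only relative to [Z]. *)
        exists (fun w => forall k, In k (seq 0 (S N)) ->
          exists U, (op U /\ forall v, Z v -> U v -> (C k z <-> C k v)) /\ U w).
        split; [split|].
        -- apply open_forall_in. intros k _. apply open_union. now intros U [].
        -- intros w Zw Hw. apply (Hb w Zw). apply Rlt_trans with (2 := Hlt).
           apply Hball. intros k Hk. destruct (Hw k) as (U & [_ HU] & Uw).
           { apply in_seq. lia. }
           now apply HU.
        -- intros k _. destruct (HC k) as (V & W & HV & HW & HVW).
           destruct (classic (C k z)) as [Ck|nCk].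
           ++ exists V. repeat split; auto; [|now apply HVW].
              intros _. now apply (HVW v).
           ++ exists W. split; [|now apply HVW]. split; [auto|].
              intros v Zv Wv. apply (HVW v Zv) in Wv. tauto.
      * intros (U & [_ HU] & Uz). auto.
Qed.

(** * Countable networks, whose members need not be open *)

Definition countable_network (N : nat -> Y -> Prop) : Prop :=
  forall z V, Z z -> op V -> V z ->
    exists n, N n z /\ forall w, Z w -> N n w -> V w.

(** One clopen set is chosen for each pair of network members that some clopen set separates. These
    countably many sets separate points, since a clopen set and its complement each contain a
    network member around the given point. *)
Lemma countable_network_metrizable (N : nat -> Y -> Prop) :
  totally_disconnected_in op Z -> countable_network N -> metrizable_in op Z.
Proof.
  intros Htd HN.
  (* [k] codes a pair of members by Cantor pairing. Quantifying over [D] leaves [C] arbitrary for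
     pairs that cannot be separated. *)
  assert (Hch : forall k, exists C, clopen_in C /\
    forall D, clopen_in D ->
      (forall z, Z z -> N (fst (of_nat k)) z -> D z) ->
      (forall z, Z z -> N (snd (of_nat k)) z -> ~ D z) ->
      (forall z, Z z -> N (fst (of_nat k)) z -> C z) /\
      (forall z, Z z -> N (snd (of_nat k)) z -> ~ C z)).
  { intros k. destruct (classic (exists D, clopen_in D /\
      (forall z, Z z -> N (fst (of_nat k)) z -> D z) /\
      (forall z, Z z -> N (snd (of_nat k)) z -> ~ D z))) as [(D & HD & H1 & H2)|H].
    - exists D. auto.
    - exists (fun _ => True). split.
      + exists (fun _ => True), (fun _ => False). split; [apply Htop|]. split.
        * apply open_local. easy.
        * intros z _. tauto.
      + intros D HD H1 H2. destruct H. now exists D. }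
  apply choice in Hch. destruct Hch as [C HC].
  apply separating_clopen_metrizable with C; [apply HC|].
  intros x y Zx Zy Hxy.
  destruct (totally_disconnected_clopen x y Htd Zx Zy Hxy) as (D & HD & Dx & nDy).
  pose proof HD as (V & W & HV & HW & HVW).
  destruct (HN x V Zx HV ltac:(now apply HVW)) as [i [Hi1 Hi2]].
  destruct (HN y W Zy HW ltac:(now apply HVW)) as [j [Hj1 Hj2]].
  exists (to_nat (i, j)). destruct (HC (to_nat (i, j))) as [_ H].
  rewrite cancel_of_to in H. simpl in H. destruct (H D HD) as [H1 H2]; auto.
  - intros z Zz Nz. apply (HVW z Zz). auto.
  - intros z Zz Nz. apply (HVW z Zz). auto.
Qed.

End Topology.

(** * The split interval *)

Section Split.

Variables (I : Type) (r : I -> R) (f : I -> R -> R).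
Hypothesis r_inj : forall xi eta, r xi = r eta -> xi = eta.
Hypothesis r_01 : forall xi, in01 (r xi).
Hypothesis f_split : forall xi, splitting_function (r xi) (f xi).

Lemma split_point_in01 p : split_point r f p -> in01 (fst p).
Proof. intros [(xi & t & _ & -> & _)|[H _]]; auto. Qed.

(** A point has a free coordinate only at the index of its own base point; all others are values of
    the splitting functions. *)
Lemma split_point_coord p xi :
  split_point r f p -> fst p <> r xi -> snd p xi = f xi (fst p).
Proof.
  intros [(eta & t & _ & H1 & _ & H2)|[_ [_ H]]] Hne; [|auto].
  rewrite H1. apply H2. intros ->. auto.
Qed.

Lemma split_point_inpm1 p xi : split_point r f p -> inpm1 (snd p xi).
Proof.
  intros Hp. destruct (Req_dec (fst p) (r xi)) as [He|Hne].
  - destruct Hp as [(eta & t & Ht & H1 & H2 & _)|[_ [H _]]]; [|now destruct (H xi)].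
    assert (eta = xi) as -> by (apply r_inj; congruence). now rewrite H2.
  - rewrite (split_point_coord p xi Hp Hne). apply f_split; auto using split_point_in01.
Qed.

Lemma split_point_fibre_eq p q xi :
  split_point r f p -> split_point r f q -> fst p = r xi -> fst q = r xi ->
  snd p xi = snd q xi -> p = q.
Proof.
  intros Hp Hq Ep Eq E. destruct p as [a u], q as [b v]. simpl in *. subst a b.
  f_equal. apply functional_extensionality. intros eta.
  destruct (classic (eta = xi)) as [->|Hne]; [exact E|].
  assert (r xi <> r eta) by (intros H; apply Hne; symmetry; auto).
  pose proof (split_point_coord _ eta Hp) as Cp.
  pose proof (split_point_coord _ eta Hq) as Cq.
  simpl in *. rewrite Cp, Cq; auto.
Qed.

(** This is the point $x_{\xi,t}$; equality in [I] is decided classically. *)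
Definition fibre_point (xi : I) (t : R) : R * (I -> R) :=
  (r xi, fun eta => if excluded_middle_informative (eta = xi) then t else f eta (r xi)).

Lemma snd_fibre_point xi t : snd (fibre_point xi t) xi = t.
Proof. simpl. now destruct excluded_middle_informative. Qed.

Lemma split_fibre_point xi t : inpm1 t -> split_point r f (fibre_point xi t).
Proof.
  intros Ht. left. exists xi, t. repeat split; try apply Ht.
  - apply snd_fibre_point.
  - intros eta Hne. simpl. now destruct excluded_middle_informative.
Qed.

(* Near a point of the fibre over [r xi] only the base coordinate and the
   coordinate [xi] matter, since the other coordinates are continuous functions
   of the base coordinate there. *)
Lemma split_local_base U p :
  prod_open U -> split_point r f p -> U p ->
  exists delta, 0 < delta /\ forall q, split_point r f q ->
    Rabs (fst q - fst p) < delta ->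
    (forall xi, fst p = r xi -> Rabs (snd q xi - snd p xi) < delta) -> U q.
Proof.
  intros HU Hp Up. destruct (HU p Up) as (e & He & l & Hl).
  assert (H : exists delta, 0 < delta /\ delta <= e /\ forall q, split_point r f q ->
    Rabs (fst q - fst p) < delta ->
    (forall xi, fst p = r xi -> Rabs (snd q xi - snd p xi) < delta) ->
    forall i, In i l -> Rabs (snd q i - snd p i) < e).
  { clear Hl. induction l as [|i l (d & Hd & Hde & IH)].
    - exists e. repeat split; try lra. intros q _ _ _ i [].
    - destruct (Req_dec (fst p) (r i)) as [E|E].
      + exists d. repeat split; auto. intros q Hq H1 H2 j [<-|Hj]; [|now apply IH].
        specialize (H2 _ E). lra.
      + destruct (f_split i) as (_ & Hc & _).
        destruct (Hc (fst p) (split_point_in01 p Hp) E e He) as (d1 & Hd1 & Hf).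
        assert (Hd2 : 0 < Rabs (fst p - r i)) by (apply Rabs_pos_lt; lra).
        (* The last bound keeps [fst q] away from [r i], so that coordinate [i] of [q] is also a
           value of [f i]. *)
        exists (Rmin d (Rmin d1 (Rabs (fst p - r i)))). repeat split.
        * repeat apply Rmin_glb_lt; auto.
        * apply Rle_trans with (2 := Hde). apply Rmin_l.
        * intros q Hq H1 H2.
          apply Rmin_Rgt in H1. destruct H1 as [H1 H3].
          apply Rmin_Rgt in H3. destruct H3 as [H3 H4].
          intros j [<-|Hj].
          -- assert (Eq : fst q <> r i).
             { intros Eq. rewrite Eq, Rabs_minus_sym in H4. lra. }
             rewrite (split_point_coord p i Hp E), (split_point_coord q i Hq Eq).
             apply Hf; auto using split_point_in01.
          -- apply IH; auto. intros xi Exi. specialize (H2 xi Exi).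
             apply Rmin_Rgt in H2. apply H2. }
  destruct H as (d & Hd & Hde & H). exists d. split; [exact Hd|].
  intros q Hq H1 H2. apply Hl; [lra|]. apply H; auto.
Qed.

(** A tube lemma: the fibre is parametrized by $[-1,1]$, whose compactness gives one radius for all
    its points. *)
Lemma split_tube U xi :
  prod_open U -> (forall q, split_point r f q -> fst q = r xi -> U q) ->
  exists delta, 0 < delta /\ forall q, split_point r f q ->
    Rabs (fst q - r xi) < delta -> U q.
Proof.
  intros HU HF.
  assert (Hch : forall t, exists d : posreal, inpm1 t ->
    forall q, split_point r f q -> Rabs (fst q - r xi) < d ->
      Rabs (snd q xi - t) < d -> U q).
  { intros t. destruct (classic (inpm1 t)) as [Ht|Ht].
    - assert (Hs := split_fibre_point xi t Ht).
      destruct (split_local_base U _ HU Hs (HF _ Hs eq_refl)) as (d & Hd & H).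
      exists (mkposreal d Hd). intros _ q Hq H1 H2. apply H; auto.
      intros eta E. apply r_inj in E. subst eta. now rewrite snd_fibre_point.
    - exists (mkposreal 1 Rlt_0_1). easy. }
  apply choice in Hch. destruct Hch as [delta Hdelta].
  destruct (compactness_value_1d (-1) 1 delta) as [d Hd].
  exists d. split; [apply cond_pos|]. intros q Hq Hlt.
  (* [compactness_value_1d] provides the nearby [t] only under a double negation. *)
  apply NNPP. intros nU. apply (Hd (snd q xi)); [now apply split_point_inpm1|].
  intros (t & Ht & H1 & H2). apply nU. apply (Hdelta t); auto. lra.
Qed.

(** Otherwise the indicator of [P] with values 1 and -1 would be continuous and change sign without
    a zero. *)
Lemma locally_constant_interval (P : R -> Prop) :
  (forall t, -1 <= t <= 1 -> exists d, 0 < d /\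
    forall s, -1 <= s <= 1 -> Rabs (s - t) < d -> (P s <-> P t)) ->
  forall s t, -1 <= s <= 1 -> -1 <= t <= 1 -> P s -> P t.
Proof.
  intros Hloc.
  (* Clamping extends the indicator to the whole line, as [IVT_cor] asks for continuity
     everywhere. *)
  set (clamp := fun t => Rmax (-1) (Rmin 1 t)).
  assert (Hcl : forall t, -1 <= clamp t <= 1).
  { intros t. unfold clamp, Rmax, Rmin. repeat destruct Rle_dec; lra. }
  assert (Hid : forall t, -1 <= t <= 1 -> clamp t = t).
  { intros t Ht. unfold clamp, Rmax, Rmin. repeat destruct Rle_dec; lra. }
  set (h := fun t => if excluded_middle_informative (P (clamp t)) then 1 else -1).
  assert (Hh : continuity h).
  { intros t e He. destruct (Hloc (clamp t) (Hcl t)) as (d & Hd & H).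
    exists d. split; [exact Hd|]. intros s [_ Hs]. simpl in *. unfold Rdist in *.
    assert (E : P (clamp s) <-> P (clamp t)).
    { apply H; [auto|]. revert Hs. unfold clamp, Rmax, Rmin, Rabs.
      repeat destruct Rle_dec; repeat destruct Rcase_abs; lra. }
    unfold h. do 2 destruct excluded_middle_informative; try tauto;
      rewrite Rminus_diag, Rabs_R0; exact He. }
  assert (Hz : forall t, h t <> 0).
  { intros t. unfold h. destruct excluded_middle_informative; lra. }
  intros s t Hs Ht Ps. apply NNPP. intros nPt.
  assert (hs : h s = 1).
  { unfold h. rewrite Hid by auto. now destruct excluded_middle_informative. }
  assert (ht : h t = -1).
  { unfold h. rewrite Hid by auto. now destruct excluded_middle_informative. }
  destruct (Rle_or_lt s t).
  - destruct (IVT_cor h s t Hh) as [z [_ Hz0]]; [auto| |now apply (Hz z)].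
    rewrite hs, ht. lra.
  - destruct (IVT_cor h t s Hh) as [z [_ Hz0]]; [lra| |now apply (Hz z)].
    rewrite hs, ht. lra.
Qed.

(** * Images of fibres under a continuous map *)

Variables (Y : Type) (opY : (Y -> Prop) -> Prop) (g : R * (I -> R) -> Y).
Hypothesis g_cont : forall V, opY V -> exists U, prod_open U /\
  forall p, split_point r f p -> (V (g p) <-> U p).

(** The fibre is the arc traced by [fibre_point xi t]; a separation of its image would pull back to
    a nonconstant, locally constant predicate on $[-1,1]$. *)
Lemma fibre_image_connected xi :
  connected_in opY (fun y => exists q, split_point r f q /\ fst q = r xi /\ g q = y).
Proof.
  intros (U & V & HU & HV & Hcov & (y & (a & Ha & Ea & <-) & Ua) &
    (y' & (b & Hb & Eb & <-) & Vb) & Hdis).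
  assert (Hloc : forall W, opY W -> forall t, -1 <= t <= 1 -> W (g (fibre_point xi t)) ->
    exists d, 0 < d /\ forall s, -1 <= s <= 1 -> Rabs (s - t) < d ->
      W (g (fibre_point xi s))).
  { intros W HW t Ht Wt. destruct (g_cont W HW) as (W' & HW' & E).
    assert (Hst := split_fibre_point xi t Ht). apply E in Wt; [|exact Hst].
    destruct (split_local_base W' _ HW' Hst Wt) as (d & Hd & H).
    exists d. split; [exact Hd|]. intros s Hs Hlt.
    assert (Hss := split_fibre_point xi s Hs). apply E; [exact Hss|].
    apply H; [exact Hss| |].
    - simpl. now rewrite Rminus_diag, Rabs_R0.
    - intros eta Eeta. apply r_inj in Eeta. subst eta. now rewrite !snd_fibre_point. }
  assert (Hin : forall t, -1 <= t <= 1 -> exists q, split_point r f q /\ fst q = r xi /\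
    g q = g (fibre_point xi t)).
  { intros t Ht. exists (fibre_point xi t). repeat split. now apply split_fibre_point. }
  assert (Hpt : forall q, split_point r f q -> fst q = r xi -> q = fibre_point xi (snd q xi)).
  { intros q Hq E. apply (split_point_fibre_eq _ _ xi); auto.
    - now apply split_fibre_point, split_point_inpm1.
    - now rewrite snd_fibre_point. }
  assert (Ub : U (g b)).
  { rewrite (Hpt b Hb Eb).
    apply (locally_constant_interval (fun t => U (g (fibre_point xi t)))) with (snd a xi).
    - intros t Ht. destruct (Hcov _ (Hin t Ht)) as [Ut|Vt].
      + destruct (Hloc U HU t Ht Ut) as (d & Hd & H). exists d. split; [exact Hd|].
        intros s Hs Hlt. specialize (H s Hs Hlt). tauto.
      + destruct (Hloc V HV t Ht Vt) as (d & Hd & H). exists d. split; [exact Hd|].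
        intros s Hs Hlt. specialize (H s Hs Hlt).
        pose proof (Hdis _ (Hin s Hs)). pose proof (Hdis _ (Hin t Ht)). tauto.
    - now apply split_point_inpm1.
    - now apply split_point_inpm1.
    - now rewrite <- Hpt. }
  apply (Hdis (g b)); [|auto]. exists b. auto.
Qed.

(** * Fibres cut by the preimage of [Z] *)

Variable Z : Y -> Prop.
Hypothesis HZclosed : opY (fun y => ~ Z y).

Definition partial_fibre (x : R) : Prop :=
  exists xi, r xi = x /\
    (exists p, split_point r f p /\ fst p = r xi /\ Z (g p)) /\
    (exists q, split_point r f q /\ fst q = r xi /\ ~ Z (g q)).

(** Suppose these points are dense in an interval, and let [q] over one of them, [r xi], map outside
    [Z]. Some [y] near [r xi] has [f xi y] near [snd q xi], so all points over a neighbourhood of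
    [y] are close to [q] and map outside [Z]; yet partial fibres accumulate at [y]. *)
Lemma partial_fibre_nowhere_dense : nowhere_dense partial_fibre.
Proof.
  intros (x & e & He & Hcl).
  destruct (Hcl x ltac:(rewrite Rminus_diag, Rabs_R0; exact He) e He)
    as (z & (xi & <- & _ & (q & Hq & Eq & nZq)) & Hx).
  destruct (g_cont _ HZclosed) as (U & HU & HUZ).
  apply HUZ in nZq; [|exact Hq].
  destruct (split_local_base U q HU Hq nZq) as (d & Hd & Hloc).
  destruct (f_split xi) as (_ & Hc & Hdense).
  destruct (Hdense (Rmin d (e - Rabs (r xi - x)))) with (t := snd q xi) (eps := d / 2)
    as (y & Hy & Hne & Hyr & Hft).
  { apply Rmin_glb_lt; lra. }
  { now apply split_point_inpm1. }
  { lra. }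
  apply Rmin_Rgt in Hyr. destruct Hyr as [Hyd Hye].
  destruct (Hc y Hy Hne (d / 2)) as (d2 & Hd2 & Hf); [lra|].
  assert (Hpos : 0 < Rabs (y - r xi)) by (apply Rabs_pos_lt; lra).
  (* The three bounds control the change of [f xi], exclude [r xi] itself, and keep the new base
     point within [d] of [r xi]. *)
  destruct (Hcl y) with (eps := Rmin d2 (Rmin (Rabs (y - r xi)) (d - Rabs (y - r xi))))
    as (w & (zeta & <- & (p & Hp & Ep & Zp) & _) & Hw).
  { replace (y - x) with ((y - r xi) + (r xi - x)) by ring.
    apply Rle_lt_trans with (1 := Rabs_triang _ _). lra. }
  { repeat apply Rmin_glb_lt; lra. }
  apply Rmin_Rgt in Hw. destruct Hw as [Hw1 Hw].
  apply Rmin_Rgt in Hw. destruct Hw as [Hw2 Hw3].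
  assert (Hneq : r zeta <> r xi).
  { intros E. rewrite E, Rabs_minus_sym in Hw2. lra. }
  apply (proj2 (HUZ p Hp)); [|exact Zp]. apply Hloc; [exact Hp| |].
  - rewrite Ep, Eq. replace (r zeta - r xi) with ((r zeta - y) + (y - r xi)) by ring.
    apply Rle_lt_trans with (1 := Rabs_triang _ _). lra.
  - intros eta E. rewrite Eq in E. apply r_inj in E. subst eta.
    rewrite (split_point_coord p xi Hp) by congruence. rewrite Ep.
    specialize (Hf (r zeta) (r_01 zeta) Hneq Hw1).
    replace (f xi (r zeta) - snd q xi) with
      ((f xi (r zeta) - f xi y) + (f xi y - snd q xi)) by ring.
    apply Rle_lt_trans with (1 := Rabs_triang _ _). lra.
Qed.

(** * A countable network of box images *)

Lemma near_grid_point (n : nat) (x : R) :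
  0 <= x -> exists j, Rabs (x - INR j / (INR n + 1)) < / (INR n + 1).
Proof.
  intros Hx. assert (Hn : 0 < INR n + 1) by (pose proof (pos_INR n); lra).
  destruct (nfloor_ex (x * (INR n + 1))) as [j [H1 H2]].
  { apply Rmult_le_pos; lra. }
  exists j.
  replace (x - INR j / (INR n + 1)) with ((x * (INR n + 1) - INR j) * / (INR n + 1))
    by (field; lra).
  assert (0 < / (INR n + 1)) by now apply Rinv_0_lt_compat.
  rewrite Rabs_mult, (Rabs_pos_eq (/ _)) by lra.
  rewrite <- (Rmult_1_l (/ (INR n + 1))) at 2.
  apply Rmult_lt_compat_r; [auto|]. rewrite Rabs_pos_eq; lra.
Qed.

(* [m = 0] stands for no constraint on the split coordinates; [m = S k]
   constrains the coordinate [xi] with [r xi = e k]. *)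
Definition box (e : nat -> R) (n j k m : nat) (q : R * (I -> R)) : Prop :=
  Rabs (fst q - INR j / (INR n + 1)) < / (INR n + 1) /\
  match m with
  | O => True
  | S i => exists xi, r xi = e i /\
      Rabs (snd q xi + 1 - INR k / (INR n + 1)) < / (INR n + 1)
  end.

(** The index codes four numbers by iterated Cantor pairing. Images of boxes need not be open, hence
    a network and not a base. *)
Definition box_images (e : nat -> R) (i : nat) (y : Y) : Prop :=
  exists q, split_point r f q /\ g q = y /\
    let (u, v) := of_nat i in
    box e (fst (of_nat u)) (snd (of_nat u)) (fst (of_nat v)) (snd (of_nat v)) q.

Lemma box_images_to_nat e n j k m y :
  box_images e (to_nat (to_nat (n, j), to_nat (k, m))) y <->
  exists q, split_point r f q /\ g q = y /\ box e n j k m q.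
Proof. unfold box_images. now rewrite !cancel_of_to. Qed.

Lemma small_grid d : 0 < d -> exists n, 2 * / (INR n + 1) < d.
Proof.
  intros Hd. destruct (nfloor_ex (2 / d)) as [n [_ Hn]].
  { apply Rlt_le, Rdiv_lt_0_compat; lra. }
  exists n. pose proof (pos_INR n). apply Rmult_lt_reg_r with (INR n + 1); [lra|].
  rewrite Rmult_assoc, Rinv_l by lra. rewrite Rmult_1_r.
  apply Rmult_lt_compat_r with (r := d) in Hn; [|exact Hd].
  unfold Rdiv in Hn. rewrite Rmult_assoc, Rinv_l in Hn by lra. lra.
Qed.

Lemma Rabs_minus_lt_common a b c h d :
  Rabs (a - c) < h -> Rabs (b - c) < h -> 2 * h < d -> Rabs (a - b) < d.
Proof. intros H1 H2. apply Rabs_def2 in H1, H2. intros H. apply Rabs_def1; lra. Qed.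

Hypothesis g_onto : forall y, exists p, split_point r f p /\ g p = y.

(** Over a split point listed by [e], a box must also constrain the split coordinate. Elsewhere a
    base interval suffices, since the fibre is a single point or is collapsed by [g]. *)
Lemma box_images_network (e : nat -> R) :
  totally_disconnected_in opY Z ->
  (forall x, partial_fibre x -> exists n, e n = x) ->
  countable_network Y opY Z (box_images e).
Proof.
  intros Htd He z V Zz HV Vz. destruct (g_onto z) as (p & Hp & <-).
  destruct (g_cont V HV) as (U & HU & HUV).
  assert (Up : U p) by now apply HUV.
  assert (Hbase : (exists d, 0 < d /\ forall q, split_point r f q ->
      Rabs (fst q - fst p) < d -> U q) ->
    exists n, box_images e n (g p) /\ forall w, Z w -> box_images e n w -> V w).
  { intros (d & Hd & H). destruct (small_grid d Hd) as [n Hn].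
    destruct (near_grid_point n (fst p)) as [j Hj]; [now apply split_point_in01|].
    exists (to_nat (to_nat (n, j), to_nat (0%nat, 0%nat))). split.
    - apply box_images_to_nat. exists p. repeat split; auto.
    - intros w _ Hw. apply box_images_to_nat in Hw.
      destruct Hw as (q & Hq & <- & Hb & _). apply HUV; [exact Hq|]. apply H; [exact Hq|].
      eapply Rabs_minus_lt_common; eassumption. }
  destruct (classic (exists xi, fst p = r xi)) as [[xi E]|Hno].
  - destruct (classic (exists m, e m = r xi)) as [[m Em]|Hm].
    + destruct (split_local_base U p HU Hp Up) as (d & Hd & H).
      destruct (small_grid d Hd) as [n Hn].
      destruct (near_grid_point n (fst p)) as [j Hj]; [now apply split_point_in01|].
      (* Adding 1 moves the coordinate into $[0,2]$, where natural numbers index the grid. *)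
      destruct (near_grid_point n (snd p xi + 1)) as [k Hk].
      { pose proof (split_point_inpm1 p xi Hp) as []. lra. }
      exists (to_nat (to_nat (n, j), to_nat (k, S m))). split.
      * apply box_images_to_nat. exists p. repeat split; auto. exists xi. auto.
      * intros w _ Hw. apply box_images_to_nat in Hw.
        destruct Hw as (q & Hq & <- & Hb & (eta & Eeta & Hb2)).
        assert (eta = xi) as -> by (apply r_inj; congruence).
        apply HUV; [exact Hq|]. apply H; [exact Hq| |].
        -- eapply Rabs_minus_lt_common; eassumption.
        -- intros eta E'. assert (eta = xi) as -> by (apply r_inj; congruence).
           replace (snd q xi - snd p xi) with ((snd q xi + 1) - (snd p xi + 1)) by ring.
           eapply Rabs_minus_lt_common; eassumption.
    (* The fibre is not partial and [p] maps into [Z], so the whole fibre does. Its connected image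
       is the single point [g p] of [V], so [U] contains the fibre and hence a tube around it. *)
    + apply Hbase. rewrite E. apply split_tube; [exact HU|].
      intros q Hq Eq. apply HUV; [exact Hq|].
      replace (g q) with (g p); [exact Vz|].
      apply (Htd _) with (2 := fibre_image_connected xi).
      * intros y (q' & Hq' & Eq' & <-). apply NNPP. intros nZ. apply Hm, He.
        exists xi. split; [reflexivity|]. split; [now exists p|now exists q'].
      * now exists p.
      * now exists q.
  (* No [r xi] equals the base point, so the condition on split coordinates is vacuous. *)
  - apply Hbase. destruct (split_local_base U p HU Hp Up) as (d & Hd & H).
    exists d. split; [exact Hd|]. intros q Hq Hlt. apply H; auto.
    intros xi E. destruct Hno. now exists xi.
Qed.

End Split.

(** * Metrizability of totally disconnected compact subspaces *)

Theorem theorem4p3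
  (I : Type) (r : I -> R) (f : I -> R -> R)
  (r_inj : forall xi eta, r xi = r eta -> xi = eta)
  (r_01 : forall xi, in01 (r xi))
  (r_luzin : luzin_set (fun x => exists xi, r xi = x))
  (f_split : forall xi, splitting_function (r xi) (f xi))
  (Y : Type) (opY : (Y -> Prop) -> Prop)
  (HtopY : is_topology opY) (HhausY : hausdorff opY)
  (g : R * (I -> R) -> Y)
  (g_cont : forall V, opY V -> exists U, prod_open U /\
       forall p, split_point r f p -> (V (g p) <-> U p))
  (g_onto : forall y, exists p, split_point r f p /\ g p = y)
  (Z : Y -> Prop) (HZc : compact_in opY Z) (HZnm : ~ metrizable_in opY Z) :
  ~ totally_disconnected_in opY Z.
Proof.
  intros Htd. apply HZnm.
  assert (HZclosed : opY (fun y => ~ Z y)) by now apply compact_compl_open.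
  destruct r_luzin as [_ HL].
  (* Every partial fibre lies over a point of the Luzin set, so the sequence [e] runs through all
     their base points. *)
  destruct (HL (partial_fibre I r f Y g Z)) as [e He].
  { now apply partial_fibre_nowhere_dense with opY. }
  apply countable_network_metrizable with (box_images I r f Y g e); auto.
  apply box_images_network; auto.
  intros x Hx. apply He. split; [|exact Hx].
  destruct Hx as [xi [E _]]. now exists xi.
Qed.
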